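(* Let $a_1,a_2,a_3>0$ be real numbers, $\Delta=\sqrt{a_1a_2a_3}$, $\Omega=\mathrm{diag}(a_1,a_2,a_3)$, let $\mathbf u=(u_1,u_2,u_3)\in\mathbb R^3_{a_1,a_2,a_3}$, and let $$T=\Delta\begin{bmatrix}0&-u_3/a_1&u_2/a_1\\ u_3/a_2&0&-u_1/a_2\\ -u_2/a_3&u_1/a_3&0\end{bmatrix}.$$ Then $I-T$ is invertible and $$R^{\mathcal B,\mathbf u}=(I+T)(I-T)^{-1}$$ is an elliptical rotation matrix on the ellipsoid $a_1x^2+a_2y^2+a_3z^2=1$, where $\mathbf u$ is the rotation axis (i.e. $R^{\mathcal B,\mathbf u}\mathbf u=\mathbf u$). Furthermore, with $\|\mathbf u\|_{\mathcal B}^2=a_1u_1^2+a_2u_2^2+a_3u_3^2$, $$R^{\mathcal B,\mathbf u}=\frac{1}{1+\|\mathbf u\|_{\mathcal B}^2}\begin{bmatrix} 1+a_1u_1^2-a_2u_2^2-a_3u_3^2 & 2a_2u_1u_2-\tfrac{2\Delta u_3}{a_1} & 2a_3u_1u_3+\tfrac{2\Delta u_2}{a_1}\\ 2a_1u_1u_2+\tfrac{2\Delta u_3}{a_2} & 1-a_1u_1^2+a_2u_2^2-a_3u_3^2 & 2a_3u_2u_3-\tfrac{2\Delta u_1}{a_2}\\ 2a_1u_1u_3-\tfrac{2\Delta u_2}{a_3} & 2a_2u_2u_3+\tfrac{2\Delta u_1}{a_3} & 1-a_1u_1^2-a_2u_2^2+a_3u_3^2 \end{bmatrix}.$$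
   Context: $\mathbb R^3_{a_1,a_2,a_3}$ denotes $\mathbb R^3$ with the elliptical inner product $\mathcal B(\mathbf u,\mathbf w)=a_1u_1w_1+a_2u_2w_2+a_3u_3w_3=\mathbf u^t\Omega\mathbf w$ and norm $\|\mathbf u\|_{\mathcal B}=\sqrt{\mathcal B(\mathbf u,\mathbf u)}$. A matrix $R\in\mathbb R^{3\times3}$ is an elliptical rotation matrix (on the ellipsoid $a_1x^2+a_2y^2+a_3z^2=1$) if $R^t\Omega R=\Omega$ and $\det R=1$. *)

(* Defs.v *)
From HB Require Import structures.
From mathcomp Require Import all_boot all_order all_algebra.
From mathcomp Require Import reals.

Set Implicit Arguments.
Unset Strict Implicit.
Unset Printing Implicit Defensive.

Import Order.TTheory GRing.Theory Num.Theory.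
Local Open Scope ring_scope.

(* Matrices given by the list of their rows; missing entries are 0. *)
Definition mx3 (R : realType) (rows : seq (seq R)) : 'M[R]_3 :=
  \matrix_(i < 3, j < 3) nth 0 (nth [::] rows i) j.

Definition vec3 (R : realType) (x y z : R) : 'cV[R]_3 :=
  \col_(i < 3) nth 0 [:: x; y; z] i.

Definition Omega (R : realType) (a1 a2 a3 : R) : 'M[R]_3 :=
  diag_mx (vec3 a1 a2 a3)^T.

(* The row index 2 is 2%:R in the ring 'I_3, i.e., the last coordinate. *)
Definition ellip_prod (R : realType) (a1 a2 a3 : R) (u w : 'cV[R]_3) : R :=
  a1 * u 0 0 * w 0 0 + a2 * u 1 0 * w 1 0 + a3 * u 2 0 * w 2 0.

Lemma ellip_prodE (R : realType) (a1 a2 a3 : R) (u w : 'cV[R]_3) :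
  ellip_prod a1 a2 a3 u w = (u^T *m Omega a1 a2 a3 *m w) 0 0.
Proof.
rewrite /Omega mul_mx_diag mxE !big_ord_recl big_ord0 !mxE /= addr0 addrA.
rewrite /ellip_prod ![_ * a1]mulrC ![_ * a2]mulrC ![_ * a3]mulrC.
by congr (_ + _ + _); congr (_ * u _ _ * w _ _); apply/val_inj.
Qed.

Definition ellip_norm (R : realType) (a1 a2 a3 : R) (u : 'cV[R]_3) : R :=
  Num.sqrt (ellip_prod a1 a2 a3 u u).

Definition ellip_rotation (R : realType) (a1 a2 a3 : R) (M : 'M[R]_3) : Prop :=
  M^T *m Omega a1 a2 a3 *m M = Omega a1 a2 a3 /\ \det M = 1.

(* Main.v *)
(* R = (I + T)(I - T)^-1 is the Cayley transform of T = Delta Omega^-1 [u]_x.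
   The matrix Omega T = Delta [u]_x is skew-symmetric, so R preserves Omega, and
   T u = Delta Omega^-1 (u x u) = 0, so R fixes u. As Delta^2 = a1 a2 a3, both
   det (I + T) and det (I - T) equal 1 + |u|_B^2 > 0; hence I - T is invertible
   and det R = 1. The closed form M / (1 + |u|_B^2) is checked on
   M (I - T) = (1 + |u|_B^2) (I + T). *)
Require Import Defs.
From mathcomp Require Import all_boot all_order all_algebra.
From mathcomp Require Import reals ring.
Import Order.TTheory GRing.Theory Num.Theory.
Local Open Scope ring_scope.

Local Notation rows3 a b c d e f g h i :=
  [:: [:: a; b; c]; [:: d; e; f]; [:: g; h; i]] (only parsing).

(** This and the next four lemmas collapse a matrix expression into one literal [mx3], so that a
    matrix identity splits into nine scalar goals for [ring] or [field]. *)
Lemma mx3_scalar (R : realType) (k : R) :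
  k%:M = mx3 (rows3 k 0 0 0 k 0 0 0 k).
Proof. by apply/matrixP => -[[|[|[|//]]] ?] [[|[|[|//]]] ?]; rewrite !mxE. Qed.

Lemma mx3_add (R : realType)
    (a b c d e f g h i a' b' c' d' e' f' g' h' i' : R) :
  mx3 (rows3 a b c d e f g h i) + mx3 (rows3 a' b' c' d' e' f' g' h' i') =
  mx3 (rows3 (a + a') (b + b') (c + c') (d + d') (e + e') (f + f')
             (g + g') (h + h') (i + i')).
Proof. by apply/matrixP => -[[|[|[|//]]] ?] [[|[|[|//]]] ?]; rewrite !mxE. Qed.

Lemma mx3_scale (R : realType) (k a b c d e f g h i : R) :
  k *: mx3 (rows3 a b c d e f g h i) =
  mx3 (rows3 (k * a) (k * b) (k * c) (k * d) (k * e) (k * f)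
             (k * g) (k * h) (k * i)).
Proof. by apply/matrixP => -[[|[|[|//]]] ?] [[|[|[|//]]] ?]; rewrite !mxE. Qed.

Lemma mx3_tr (R : realType) (a b c d e f g h i : R) :
  (mx3 (rows3 a b c d e f g h i))^T = mx3 (rows3 a d g b e h c f i).
Proof. by apply/matrixP => -[[|[|[|//]]] ?] [[|[|[|//]]] ?]; rewrite !mxE. Qed.

Lemma mx3_mul (R : realType)
    (a b c d e f g h i a' b' c' d' e' f' g' h' i' : R) :
  mx3 (rows3 a b c d e f g h i) *m mx3 (rows3 a' b' c' d' e' f' g' h' i') =
  mx3 (rows3
    (a * a' + b * d' + c * g') (a * b' + b * e' + c * h')
    (a * c' + b * f' + c * i')
    (d * a' + e * d' + f * g') (d * b' + e * e' + f * h')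
    (d * c' + e * f' + f * i')
    (g * a' + h * d' + i * g') (g * b' + h * e' + i * h')
    (g * c' + h * f' + i * i')).
Proof.
by apply/matrixP => -[[|[|[|//]]] ?] [[|[|[|//]]] ?];
  rewrite !mxE !big_ord_recl big_ord0 !mxE /= addr0 addrA.
Qed.

Lemma mx3_mul_vec (R : realType) (a b c d e f g h i x y z : R) :
  mx3 (rows3 a b c d e f g h i) *m vec3 x y z =
  vec3 (a * x + b * y + c * z) (d * x + e * y + f * z) (g * x + h * y + i * z).
Proof.
by apply/matrixP => -[[|[|[|//]]] ?] j;
  rewrite !mxE !big_ord_recl big_ord0 !mxE /= addr0 addrA.
Qed.

Lemma det_mx3 (R : realType) (a b c d e f g h i : R) :
  \det (mx3 (rows3 a b c d e f g h i)) =
  a * (e * i - f * h) - b * (d * i - f * g) + c * (d * h - e * g).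
Proof.
rewrite (expand_det_row _ 0) !big_ord_recl big_ord0 /cofactor.
rewrite !(expand_det_row _ 0) !big_ord_recl !big_ord0 /cofactor.
by rewrite !det_mx11 !mxE /=; ring.
Qed.

Lemma OmegaE (R : realType) (a1 a2 a3 : R) :
  Omega a1 a2 a3 = mx3 (rows3 a1 0 0 0 a2 0 0 0 a3).
Proof. by apply/matrixP => -[[|[|[|//]]] ?] [[|[|[|//]]] ?]; rewrite !mxE. Qed.

(** Nonnegative weights keep the radicand nonnegative; [Num.sqrt] is 0 on negative arguments. *)
Lemma ellip_norm_sqr (R : realType) (a1 a2 a3 x y z : R) :
  0 <= a1 -> 0 <= a2 -> 0 <= a3 ->
  ellip_norm a1 a2 a3 (vec3 x y z) ^+ 2 = a1 * x ^+ 2 + a2 * y ^+ 2 + a3 * z ^+ 2.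
Proof.
move=> a1_ge0 a2_ge0 a3_ge0.
rewrite /ellip_norm /ellip_prod !mxE /= -!mulrA -!expr2 sqr_sqrtr //.
by rewrite !addr_ge0 // mulr_ge0 // sqr_ge0.
Qed.

Section Cayley.
Variables (R : comUnitRingType) (n : nat) (T : 'M[R]_n).
Hypothesis unit1T : 1%:M - T \in unitmx.

Local Notation cayley := ((1%:M + T) *m invmx (1%:M - T)).

(* Both [(I + T)^t W (I + T)] and [(I - T)^t W (I - T)] equal [W + T^t W T]. *)
Lemma cayley_isometry (W : 'M[R]_n) :
  T^T *m W = - (W *m T) -> cayley^T *m W *m cayley = W.
Proof.
move=> skewT.
have sameW : (1%:M + T)^T *m W *m (1%:M + T) = (1%:M - T)^T *m W *m (1%:M - T).
  rewrite ![(_ + _)^T]linearD /= [(- T)^T]linearN /= trmx1.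
  rewrite !(mulmxDl, mulmxDr, mulNmx, mulmxN, mul1mx, mulmx1) skewT.
  by rewrite !(mulNmx, opprK) !addrA addrNK addrK.
(* Reassociation isolates the left side of [sameW]; after the swap, each [1%:M - T] stands next to
   its own inverse. *)
rewrite trmx_mul !mulmxA -(mulmxA _ _ W) -(mulmxA _ _ (1%:M + T)) sameW.
by rewrite !mulmxA -trmx_mul mulmxV // trmx1 mul1mx -mulmxA mulmxV // mulmx1.
Qed.

(** A kernel vector of [T] is fixed by I + T and by I - T, hence also by the inverse of the
    latter. *)
Lemma cayley_fixed (u : 'cV[R]_n) : T *m u = 0 -> cayley *m u = u.
Proof.
move=> Tu0; have fix_u : (1%:M - T) *m u = u by rewrite mulmxBl mul1mx Tu0 subr0.
by rewrite -mulmxA -{1}fix_u mulKmx // mulmxDl mul1mx Tu0 addr0.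
Qed.

Lemma det_cayley : \det (1%:M + T) = \det (1%:M - T) -> \det cayley = 1.
Proof. by move=> eq_det; rewrite det_mulmx det_inv eq_det mulrV -?unitmxE. Qed.

End Cayley.

Theorem theorem3 (R : realType) (a1 a2 a3 u1 u2 u3 : R)
    (a1_gt0 : 0 < a1) (a2_gt0 : 0 < a2) (a3_gt0 : 0 < a3) :
  let Delta := Num.sqrt (a1 * a2 * a3) in
  let u := vec3 u1 u2 u3 in
  let T := Delta *: mx3
    [:: [:: 0;           - (u3 / a1);  u2 / a1];
        [:: u3 / a2;     0;            - (u1 / a2)];
        [:: - (u2 / a3); u1 / a3;      0]] in
  let RBu := (1%:M + T) *m invmx (1%:M - T) in
  [/\ 1%:M - T \in unitmx,
      ellip_rotation a1 a2 a3 RBu,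
      RBu *m u = u,
      ellip_norm a1 a2 a3 u ^+ 2 = a1 * u1 ^+ 2 + a2 * u2 ^+ 2 + a3 * u3 ^+ 2
    & RBu = (1 + ellip_norm a1 a2 a3 u ^+ 2)^-1 *: mx3
        [:: [:: 1 + a1 * u1 ^+ 2 - a2 * u2 ^+ 2 - a3 * u3 ^+ 2;
                2 * a2 * u1 * u2 - 2 * Delta * u3 / a1;
                2 * a3 * u1 * u3 + 2 * Delta * u2 / a1];
            [:: 2 * a1 * u1 * u2 + 2 * Delta * u3 / a2;
                1 - a1 * u1 ^+ 2 + a2 * u2 ^+ 2 - a3 * u3 ^+ 2;
                2 * a3 * u2 * u3 - 2 * Delta * u1 / a2];
            [:: 2 * a1 * u1 * u3 - 2 * Delta * u2 / a3;
                2 * a2 * u2 * u3 + 2 * Delta * u1 / a3;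
                1 - a1 * u1 ^+ 2 - a2 * u2 ^+ 2 + a3 * u3 ^+ 2]]].
Proof.
move=> Delta u T RBu.
have normE := @ellip_norm_sqr _ _ _ _ u1 u2 u3 (ltW a1_gt0) (ltW a2_gt0) (ltW a3_gt0).
have Delta2 : Delta ^+ 2 = a1 * a2 * a3 by rewrite sqr_sqrtr // !mulr_ge0 // ltW.
have a1_neq0 := lt0r_neq0 a1_gt0.
have a2_neq0 := lt0r_neq0 a2_gt0.
have a3_neq0 := lt0r_neq0 a3_gt0.
pose N := 1 + (a1 * u1 ^+ 2 + a2 * u2 ^+ 2 + a3 * u3 ^+ 2).
have N_neq0 : N != 0.
  by rewrite lt0r_neq0 // ltr_pwDl // !addr_ge0 // mulr_ge0 ?sqr_ge0 // ltW.
have detD : \det (1%:M + T) = N.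
  (* The terms cubic in [Delta] cancel, and [Delta2] clears the denominators of the quadratic
     ones. *)
  rewrite mx3_scalar /T mx3_scale mx3_add det_mx3 /N.
  by field: Delta2; rewrite a1_neq0 a2_neq0 a3_neq0.
have detB : \det (1%:M - T) = N.
  (* Passing to -T only changes the sign of [Delta], in which the determinant is even. *)
  rewrite mx3_scalar /T -scaleNr mx3_scale mx3_add det_mx3 /N.
  by field: Delta2; rewrite a1_neq0 a2_neq0 a3_neq0.
have unitB : 1%:M - T \in unitmx by rewrite unitmxE detB unitfE.
split=> //.
- split; last by apply: det_cayley => //; rewrite detD detB.
  apply: cayley_isometry => //.
  (* Without the common factor [Delta], row i of [Omega] cancels the denominator a_i, leaving the
     skew matrix [u]_x. *)
  rewrite OmegaE /T linearZ /= -scalemxAl -scalemxAr -scalerN; congr (_ *: _).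
  rewrite mx3_tr !mx3_mul -scaleN1r mx3_scale.
  by congr (mx3 (rows3 _ _ _ _ _ _ _ _ _)); field; rewrite ?a1_neq0 ?a2_neq0 ?a3_neq0.
- apply: cayley_fixed => //.
  rewrite /T /u -scalemxAl mx3_mul_vec.
  apply/matrixP => -[[|[|[|//]]] ?] j; rewrite !mxE /=; ring.
(* Moving both inverses across the equation avoids computing [invmx]; products of entries then bring
   in [Delta ^+ 2], which [Delta2] eliminates. *)
- apply: (canLR (mulmxK unitB)).
  rewrite normE -/N -scalemxAl; apply: (canRL (scalerK N_neq0)).
  rewrite mx3_scalar /T -scaleNr !mx3_scale !mx3_add mx3_mul mx3_scale /N.
  by congr (mx3 (rows3 _ _ _ _ _ _ _ _ _));
    field: Delta2; rewrite ?a1_neq0 ?a2_neq0 ?a3_neq0.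
Qed.
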